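(* Let $\tau\geq 2$ be an integer and let $G$ be a connected graph of order $n \geq 4\tau^2+5\tau+1$. If $\lambda_1(D(G)) \leq \lambda_1\big(D(K_{\tau-1} \vee (K_{n-\tau} \cup K_1))\big)$, then $G$ is a $\tau$-tough graph, unless $G \cong K_{\tau-1} \vee (K_{n-\tau} \cup K_1)$.
   Context: All graphs are finite and simple. For a connected graph $G$ with vertex set $\{v_1,\dots,v_n\}$, the distance matrix $D(G)$ is the $n\times n$ matrix whose $(i,j)$-entry is the length of a shortest path between $v_i$ and $v_j$; $\lambda_1(D(G))$ denotes its largest eigenvalue (the distance spectral radius). For a graph $G$ and $S\subseteq V(G)$, $G-S$ is the subgraph induced by $V(G)\setminus S$ and $c(G-S)$ is its number of connected components. For a connected non-complete graph $G$, $\tau(G)=\min\left\{\frac{|S|}{c(G-S)-1} : S\subset V(G),\ c(G-S)>1\right\}$; $G$ is called $\tau$-tough if $\tau(G)\geq \tau$ (a graph admitting no $S$ with $c(G-S)>1$, e.g. a complete graph, is regarded as $\tau$-tough). $K_m$ is the complete graph on $m$ vertices, $G_1\cup G_2$ is the disjoint union, and $G_1\vee G_2$ (the join) is obtained from $G_1\cup G_2$ by adding all edges between $V(G_1)$ and $V(G_2)$. *)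

(* Defs.v *)
From HB Require Import structures.
From mathcomp Require Import all_boot all_order all_algebra.
From mathcomp Require Import classical_sets reals.
Set Implicit Arguments.
Unset Strict Implicit.
Unset Printing Implicit Defensive.
Import Order.TTheory GRing.Theory Num.Theory.
Local Open Scope ring_scope.

Record sgraph := SGraph {
  svertex :> finType;
  sedge : rel svertex;
  sedge_sym : symmetric sedge;
  sedge_irr : irreflexive sedge }.

Definition connected_graph (G : sgraph) : Prop :=
  (0 < #|G|)%N /\ forall x y : G, connect (@sedge G) x y.

Definition graph_iso (G H : sgraph) : Prop :=
  exists2 f : G -> H, bijective f & forall x y, sedge (f x) (f y) = sedge x y.

Section Complete.
Variable m : nat.
Definition complete_edge : rel 'I_m := fun x y => x != y.
Lemma complete_edge_sym : symmetric complete_edge.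
Proof. by move=> x y; rewrite /complete_edge eq_sym. Qed.
Lemma complete_edge_irr : irreflexive complete_edge.
Proof. by move=> x; rewrite /complete_edge eqxx. Qed.
Definition complete_graph := SGraph complete_edge_sym complete_edge_irr.
End Complete.

Section UnionJoin.
Variables G1 G2 : sgraph.

Definition union_edge : rel (G1 + G2)%type := fun u v =>
  match u, v with
  | inl x, inl y => sedge x y
  | inr x, inr y => sedge x y
  | _, _ => false
  end.
Lemma union_edge_sym : symmetric union_edge.
Proof. by move=> [x|x] [y|y] //=; rewrite sedge_sym. Qed.
Lemma union_edge_irr : irreflexive union_edge.
Proof. by move=> [x|x] /=; rewrite sedge_irr. Qed.
Definition graph_union := SGraph union_edge_sym union_edge_irr.

Definition join_edge : rel (G1 + G2)%type := fun u v =>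
  match u, v with
  | inl x, inl y => sedge x y
  | inr x, inr y => sedge x y
  | _, _ => true
  end.
Lemma join_edge_sym : symmetric join_edge.
Proof. by move=> [x|x] [y|y] //=; rewrite sedge_sym. Qed.
Lemma join_edge_irr : irreflexive join_edge.
Proof. by move=> [x|x] /=; rewrite sedge_irr. Qed.
Definition graph_join := SGraph join_edge_sym join_edge_irr.
End UnionJoin.

Section Induced.
Variables (G : sgraph) (A : {set G}).
Definition induced_edge : rel {x : G | x \in A} :=
  fun x y => sedge (val x) (val y).
Lemma induced_edge_sym : symmetric induced_edge.
Proof. by move=> x y; rewrite /induced_edge sedge_sym. Qed.
Lemma induced_edge_irr : irreflexive induced_edge.
Proof. by move=> x; rewrite /induced_edge sedge_irr. Qed.
Definition induced_graph := SGraph induced_edge_sym induced_edge_irr.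
End Induced.

Definition num_components (G : sgraph) : nat := n_comp (@sedge G) predT.

(* c(G - S) *)
Definition comp_minus (G : sgraph) (S : {set G}) : nat :=
  num_components (induced_graph (~: S)).

Definition has_path_of_length (G : sgraph) (x y : G) (k : nat) : bool :=
  [exists p : k.-tuple G,
     [&& path (@sedge G) x p, last x p == y & uniq (x :: p)]].

(* A path has fewer than #|G| edges, so this [find] is the least k admitting an
   x-y path of length k; it takes the junk value #|G| when there is no path. *)
Definition gdist (G : sgraph) (x y : G) : nat :=
  find (has_path_of_length x y) (iota 0 #|G|).

Definition distance_matrix (R : realType) (G : sgraph) : 'M[R]_#|G| :=
  \matrix_(i, j) (gdist (enum_val i) (enum_val j))%:R.

(* The junk value 0 is never taken on a nonempty real symmetric matrix, the
   only case of interest; such a matrix has a (finite, nonempty) real spectrum. *)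
Definition largest_eigenvalue (R : realType) (n : nat) (A : 'M[R]_n) : R :=
  xget 0 [set a : R | eigenvalue A a
                      /\ (forall b : R, eigenvalue A b -> b <= a)]%classic.

Definition is_cut (G : sgraph) (S : {set G}) : bool := (1 < comp_minus S)%N.

Definition cut_ratio (G : sgraph) (S : {set G}) : rat :=
  #|S|%:R / ((comp_minus S).-1)%:R.

(* None when no S satisfies c(G - S) > 1, e.g. for complete graphs. *)
Definition toughness (G : sgraph) : option rat :=
  if [pick S : {set G} | is_cut S] is Some S0
  then Some (cut_ratio [arg min_(S < S0 | is_cut S) cut_ratio S]%O)
  else None.

Definition is_tough (t : rat) (G : sgraph) : bool :=
  if toughness G is Some r then t <= r else true.

Definition extremal_graph (t n : nat) : sgraph :=
  graph_join (complete_graph (t - 1))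
             (graph_union (complete_graph (n - t)) (complete_graph 1)).

(* Main.v *)
(* Deleting edges from a graph increases distances, hence the value of the distance
   quadratic form at a Perron vector x > 0; so a proper spanning subgraph of H has
   distance spectral radius larger than that of H.

   If G is not t-tough, some set S of s < t k vertices leaves k + 1 >= 2 components.
   When some vertex has degree less than t, G is isomorphic to a spanning subgraph of
   K_{t-1} v (K_{n-t} u K_1), and the comparison above forces an isomorphism.
   Otherwise every component of G - S has at least two vertices when k = 1, and
   counting the pairs that S separates gives more than 3 n ordered pairs at distance
   at least 2.  The all-ones vector then bounds the spectral radius of D(G) strictly
   below by n + 2, whereas that of the extremal graph is at most n + 2 by a weighted
   row-sum bound. *)
Require Import Defs.
From mathcomp Require Import all_boot all_order all_algebra perm.
From mathcomp Require Import reals complex ring lra zify.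
From mathcomp Require classical_sets.
Set Implicit Arguments.
Unset Strict Implicit.
Unset Printing Implicit Defensive.
Import Order.TTheory GRing.Theory Num.Theory.
Local Open Scope ring_scope.

(** * Quadratic forms and the largest eigenvalue *)

Section HermitianSpectrum.
Local Open Scope sesquilinear_scope.
Variables (C : numClosedFieldType) (n : nat) (A : 'M[C]_n).
Hypothesis A_herm : A \is hermsymmx.

Let P := spectralmx A.
Let d := spectral_diag A.

Lemma hermitian_spectralE : A = invmx P *m diag_mx d *m P.
Proof. exact/orthomx_spectralP/hermitian_normalmx. Qed.

Lemma eigenvalue_spectral_diag i : eigenvalue A (d 0 i).
Proof.
apply/eigenvalueP; exists (row i P).
  rewrite -row_mul {1}hermitian_spectralE !mulmxA mulmxV ?spectral_unit // mul1mx.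
  by apply/rowP => j; rewrite mul_diag_mx !mxE.
apply: contraTneq (spectral_unit A) => row_eq0.
rewrite -row_free_unit -kermx_eq0; apply/rowV0Pn; exists (delta_mx 0 i).
  by apply/sub_kermxP; rewrite -rowE.
by apply/rV0Pn; exists i; rewrite mxE !eqxx oner_eq0.
Qed.

Lemma hermitian_form_le (a : C) (z : 'rV[C]_n) :
  (forall i, d 0 i <= a) -> (z *m A *m z ^t* ) 0 0 <= a * (z *m z ^t* ) 0 0.
Proof.
move=> d_le; have P_unitary := spectral_unitarymx A.
have diffE : a%:M - A = invmx P *m diag_mx (const_mx a - d) *m P.
  rewrite {1}hermitian_spectralE raddfB /= diag_const_mx mulmxBr mulmxBl; congr (_ - _).
  by rewrite mul_mx_scalar -scalemxAl mulVmx ?spectral_unit // scalemx1.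
rewrite -subr_ge0.
have -> : a * (z *m z ^t* ) 0 0 - (z *m A *m z ^t* ) 0 0
    = (z *m (a%:M - A) *m z ^t* ) 0 0.
  by rewrite mulmxBr mulmxBl mul_mx_scalar -scalemxAl !mxE.
rewrite diffE invmx_unitary //; set y := z *m P ^t*.
have -> : z *m (P ^t* *m diag_mx (const_mx a - d) *m P) *m z ^t*
    = y *m diag_mx (const_mx a - d) *m y ^t*.
  by rewrite /y trmx_mul map_mxM /= trmxCK !mulmxA.
rewrite mxE sumr_ge0 // => i _; rewrite mul_mx_diag !mxE mulrAC mulr_ge0 //.
  exact: mul_conjC_ge0.
by rewrite subr_ge0.
Qed.
End HermitianSpectrum.

Definition quadform (R : pzRingType) (n : nat) (A : 'M[R]_n) (x : 'rV[R]_n) : R :=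
  (x *m A *m x^T) 0 0.

Definition sqrnorm (R : pzRingType) (n : nat) (x : 'rV[R]_n) : R := (x *m x^T) 0 0.

Lemma sqrnormE (R : pzRingType) (n : nat) (x : 'rV[R]_n) :
  sqrnorm x = \sum_i x 0 i ^+ 2.
Proof. by rewrite /sqrnorm mxE; apply: eq_bigr => i _; rewrite mxE expr2. Qed.

Lemma quadformE (R : pzRingType) (n : nat) (A : 'M[R]_n) (x : 'rV[R]_n) :
  quadform A x = \sum_i \sum_j x 0 i * A i j * x 0 j.
Proof.
rewrite /quadform mxE exchange_big /=; apply: eq_bigr => j _.
by rewrite !mxE mulr_suml.
Qed.

Lemma sqrnorm_ge0 (R : realDomainType) (n : nat) (x : 'rV[R]_n) : 0 <= sqrnorm x.
Proof. by rewrite sqrnormE sumr_ge0 // => i _; apply: sqr_ge0. Qed.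

Lemma sqrnorm_eq0 (R : realDomainType) (n : nat) (x : 'rV[R]_n) :
  (sqrnorm x == 0) = (x == 0).
Proof.
apply/eqP/eqP => [|->]; last by rewrite /sqrnorm mul0mx mxE.
rewrite sqrnormE => /psumr_eq0P x0; apply/rowP => i.
by apply/eqP; rewrite mxE -sqrf_eq0 x0 // => j _; apply: sqr_ge0.
Qed.

Lemma sqrnorm_gt0 (R : realDomainType) (n : nat) (x : 'rV[R]_n) :
  (0 < sqrnorm x) = (x != 0).
Proof. by rewrite lt_def sqrnorm_eq0 sqrnorm_ge0 andbT. Qed.

Lemma quadform_eigen (R : pzRingType) (n : nat) (A : 'M[R]_n) (x : 'rV[R]_n) (a : R) :
  x *m A = a *: x -> quadform A x = a * sqrnorm x.
Proof. by move=> xA; rewrite /quadform xA -scalemxAl mxE. Qed.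

Lemma quadform_scalar_sub (R : comPzRingType) (n : nat) (A : 'M[R]_n) (a : R)
    (x : 'rV[R]_n) :
  quadform (a%:M - A) x = a * sqrnorm x - quadform A x.
Proof. by rewrite /quadform mulmxBr mulmxBl mul_mx_scalar -scalemxAl /sqrnorm !mxE. Qed.

Lemma quadform_combination (R : comPzRingType) (n : nat) (A : 'M[R]_n) (a b : R)
    (x y : 'rV[R]_n) :
  A^T = A ->
  quadform A (a *: x - b *: y)
    = a ^+ 2 * quadform A x - 2 * (a * b) * (x *m A *m y^T) 0 0 + b ^+ 2 * quadform A y.
Proof.
move=> A_sym; have cross : (y *m A *m x^T) 0 0 = (x *m A *m y^T) 0 0.
  have -> : y *m A *m x^T = (x *m A *m y^T)^T by rewrite !trmx_mul trmxK A_sym mulmxA.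
  by rewrite mxE.
rewrite /quadform [(_ - _)^T]linearB /= [(_ *: x)^T]linearZ [(_ *: y)^T]linearZ /=.
rewrite !(mulmxBl, mulmxBr) -!scalemxAl -!scalemxAr.
move: (x *m A *m x^T) (x *m A *m y^T) (y *m A *m x^T) (y *m A *m y^T) cross.
by move=> xx xy yx yy yx_xy; rewrite !mxE yx_xy; ring.
Qed.

(* Nonnegativity at (c + 1) z - q z A, where q = |z A|^2 and c is the form at z A,
   leaves only q^2 (c - 2 (c + 1)) >= 0. *)
Lemma psd_quadform_eq0 (R : realDomainType) (n : nat) (A : 'M[R]_n) (z : 'rV[R]_n) :
  A^T = A -> (forall x, 0 <= quadform A x) -> quadform A z = 0 -> z *m A = 0.
Proof.
move=> A_sym A_psd zAz; set q := sqrnorm (z *m A); set c := quadform A (z *m A).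
have c_ge0 : 0 <= c by apply: A_psd.
have := A_psd ((c + 1) *: z - q *: (z *m A)).
rewrite quadform_combination // zAz -/c -/(sqrnorm (z *m A)) -/q.
have -> : (c + 1) ^+ 2 * 0 - 2 * ((c + 1) * q) * q + q ^+ 2 * c
    = q ^+ 2 * (c - 2 * (c + 1)) by ring.
rewrite nmulr_lge0; last by lra.
by rewrite le_eqVlt ltNge sqr_ge0 orbF sqrf_eq0 sqrnorm_eq0 => /eqP.
Qed.

Lemma symmetric_max_eigenvalue (R : rcfType) (n : nat) (A : 'M[R]_n) :
  (0 < n)%N -> A^T = A ->
  exists2 a, eigenvalue A a & forall x, quadform A x <= a * sqrnorm x.
Proof.
move=> n_gt0 A_sym; pose toC := real_complex R; pose B := map_mx toC A.
have B_herm : B \is hermsymmx.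
  apply: realsym_hermsym.
    apply/is_hermitianmxP; rewrite expr0 scale1r.
    by apply/matrixP => i j; rewrite !mxE -[in LHS]A_sym mxE.
  by apply/mxOverP => i j; rewrite mxE; apply/complex_realP; exists (A i j).
have dE i : spectral_diag B 0 i = toC (complex.Re (spectral_diag B 0 i)).
  by have /mxOverP/(_ 0 i)/complex_realP[r ->] := hermitian_spectral_diag_real B_herm.
have [i0 _ i0_max] := @arg_maxP _ _ 'I_n (Ordinal n_gt0) xpredT
  (fun i => complex.Re (spectral_diag B 0 i)) isT.
exists (complex.Re (spectral_diag B 0 i0)) => [|x].
  by have := eigenvalue_spectral_diag B_herm i0; rewrite dE eigenvalue_map.
have x_conj : (map_mx toC x ^t* )%sesqui = map_mx toC x^T.
  rewrite map_trmx; apply/realmxC/mxOverP => i j.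
  by rewrite !mxE; apply/complex_realP; eexists.
rewrite -lecR rmorphM /= -/toC -dE.
have -> : toC (quadform A x)
    = (map_mx toC x *m B *m (map_mx toC x ^t* )%sesqui) 0 0.
  by rewrite x_conj -!map_mxM mxE.
have -> : toC (sqrnorm x) = (map_mx toC x *m (map_mx toC x ^t* )%sesqui) 0 0.
  by rewrite x_conj -!map_mxM mxE.
by apply: hermitian_form_le => // i; rewrite dE [leRHS]dE lecR; apply: i0_max.
Qed.

Lemma largest_eigenvalue_unique (R : realType) (n : nat) (A : 'M[R]_n) (a : R) :
  eigenvalue A a -> (forall x, quadform A x <= a * sqrnorm x) -> largest_eigenvalue A = a.
Proof.
move=> aA a_max.
have a_ub b : eigenvalue A b -> b <= a.
  case/eigenvalueP => x xA; rewrite -sqrnorm_gt0 => x_gt0.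
  by rewrite -(ler_pM2r x_gt0) -(quadform_eigen xA).
apply: classical_sets.xget_unique => // b [/a_ub b_le /(_ a aA) a_le].
exact/le_anti/andP.
Qed.

Section LargestEigenvalue.
Variables (R : realType) (n : nat) (A : 'M[R]_n).
Hypotheses (n_gt0 : (0 < n)%N) (A_sym : A^T = A).

Lemma eigenvalue_largest : eigenvalue A (largest_eigenvalue A).
Proof.
have [a aA a_max] := symmetric_max_eigenvalue n_gt0 A_sym.
by rewrite (largest_eigenvalue_unique aA a_max).
Qed.

Lemma quadform_le_largest x : quadform A x <= largest_eigenvalue A * sqrnorm x.
Proof.
have [a aA a_max] := symmetric_max_eigenvalue n_gt0 A_sym.
by rewrite (largest_eigenvalue_unique aA a_max).
Qed.

Lemma quadform_eq_largest x :
  quadform A x = largest_eigenvalue A * sqrnorm x -> x *m A = largest_eigenvalue A *: x.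
Proof.
move=> x_max; apply/esym/eqP; rewrite -subr_eq0 -mul_mx_scalar -mulmxBr.
apply/eqP/psd_quadform_eq0.
- by rewrite linearB /= tr_scalar_mx A_sym.
- by move=> y; rewrite quadform_scalar_sub subr_ge0 quadform_le_largest.
- by rewrite quadform_scalar_sub x_max subrr.
Qed.

(* Taking absolute values does not decrease the form, so |y| is again an
   eigenvector when y is one. *)
Lemma largest_eigenvalue_perron :
  (forall i j, i != j -> 0 < A i j) ->
  exists2 x : 'rV[R]_n, forall i, 0 < x 0 i & x *m A = largest_eigenvalue A *: x.
Proof.
move=> A_gt0; have /eigenvalueP[y yA y_neq0] := eigenvalue_largest.
pose x : 'rV[R]_n := \row_i `|y 0 i|.
have sqrnorm_x : sqrnorm x = sqrnorm y.
  by rewrite !sqrnormE; apply: eq_bigr => i _; rewrite mxE real_normK ?num_real.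
have form_ge : quadform A y <= quadform A x.
  rewrite !quadformE; apply: ler_sum => i _; apply: ler_sum => j _; rewrite !mxE.
  case: (eqVneq i j) => [->|ij].
    by rewrite [leLHS]mulrAC [leRHS]mulrAC -!expr2 real_normK ?num_real.
  rewrite -[in leRHS](gtr0_norm (A_gt0 _ _ ij)) -!normrM; exact: ler_norm.
have xA : x *m A = largest_eigenvalue A *: x.
  apply/quadform_eq_largest/le_anti.
  by rewrite quadform_le_largest sqrnorm_x -(quadform_eigen yA) form_ge.
exists x => // i; rewrite mxE normr_gt0; apply/eqP => yi0.
case/rV0Pn: y_neq0 => j yj; have ji : j != i by apply: contraNneq yj => ->; rewrite yi0.
have /rowP/(_ i)/eqP := xA; rewrite !mxE yi0 normr0 mulr0 gt_eqF //.
rewrite (bigD1 j) //= ltr_pwDl ?sumr_ge0 ?mxE ?mulr_gt0 ?normr_gt0 ?A_gt0 // => k _.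
rewrite mxE; case: (eqVneq k i) => [->|ki]; first by rewrite yi0 normr0 mul0r.
by rewrite mulr_ge0 // ltW ?A_gt0.
Qed.
End LargestEigenvalue.

(* Pair x with the entrywise absolute value of an eigenvector. *)
Lemma collatz_wielandt_normr_eigenvalue_le (R : realFieldType) (n : nat) (A : 'M[R]_n)
    (x : 'cV[R]_n) (rho a : R) :
  (forall i j, 0 <= A i j) -> (forall i, 0 < x i 0) ->
  (forall i, (A *m x) i 0 <= rho * x i 0) ->
  eigenvalue A a -> `|a| <= rho.
Proof.
move=> A_ge0 x_gt0 Ax_le /eigenvalueP[y yA /rV0Pn[k yk]].
pose z : 'rV[R]_n := \row_i `|y 0 i|.
have z_ge0 i : 0 <= z 0 i by rewrite mxE.
have zA_ge i : `|a| * z 0 i <= (z *m A) 0 i.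
  have /rowP/(_ i) := yA; rewrite !mxE -normrM => <-.
  apply: le_trans (ler_norm_sum _ _ _) _; apply: ler_sum => j _.
  by rewrite normrM mxE [`|A j i|]ger0_norm.
have zx_gt0 : 0 < (z *m x) 0 0.
  rewrite mxE (bigD1 k) //= ltr_pwDl ?mulr_gt0 ?mxE ?normr_gt0 //.
  by apply: sumr_ge0 => i _; rewrite mulr_ge0 // ltW.
rewrite -(ler_pM2r zx_gt0); apply: (@le_trans _ _ ((z *m A *m x) 0 0)).
  rewrite !mxE mulr_sumr; apply: ler_sum => i _.
  by rewrite mulrA ler_wpM2r // ltW.
rewrite -mulmxA !mxE mulr_sumr; apply: ler_sum => i _.
by rewrite mulrCA ler_wpM2l.
Qed.

Lemma entrywise_le_largest_eigenvalue_eq (R : realType) (n : nat) (A B : 'M[R]_n)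
    (x : 'rV[R]_n) (rho : R) :
  B^T = B -> (forall i j, A i j <= B i j) -> (forall i, 0 < x 0 i) ->
  x *m A = rho *: x -> largest_eigenvalue B <= rho -> A = B.
Proof.
move=> B_sym AB x_gt0 xA rho_ge; apply/matrixP => i j.
have n_gt0 : (0 < n)%N by apply: leq_ltn_trans (ltn_ord i).
have gap_ge0 k l : 0 <= x 0 k * (B k l - A k l) * x 0 l.
  by rewrite !mulr_ge0 ?subr_ge0 // ltW.
have gap_eq0 : \sum_k \sum_l x 0 k * (B k l - A k l) * x 0 l = 0.
  apply/le_anti; rewrite sumr_ge0 ?andbT => [|k _]; last exact: sumr_ge0.
  have -> : \sum_k \sum_l x 0 k * (B k l - A k l) * x 0 l = quadform B x - quadform A x.
    rewrite !quadformE -sumrB; apply: eq_bigr => k _; rewrite -sumrB.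
    by apply: eq_bigr => l _; rewrite mulrBr mulrBl.
  rewrite (quadform_eigen xA) subr_le0 (le_trans (quadform_le_largest n_gt0 B_sym x)) //.
  by rewrite ler_wpM2r ?sqrnorm_ge0.
have row_eq0 := psumr_eq0P (fun k _ => sumr_ge0 _ (fun l _ => gap_ge0 k l)) gap_eq0.
have /(_ j isT)/eqP := psumr_eq0P (fun l _ => gap_ge0 i l) (row_eq0 i isT).
by rewrite !mulf_eq0 !(gt_eqF (x_gt0 _)) /= orbF subr_eq0 eq_sym => /eqP.
Qed.

(** * Distances *)

Lemma sedge_neq (G : sgraph) (x y : G) : sedge x y -> x != y.
Proof. by apply: contraTneq => ->; rewrite sedge_irr. Qed.

Lemma sedge_connect_sym (G : sgraph) : connect_sym (@sedge G).
Proof. exact/sym_connect_sym/sedge_sym. Qed.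

Lemma has_path_of_length_sym (G : sgraph) (x y : G) k :
  has_path_of_length x y k = has_path_of_length y x k.
Proof.
suff reverse (u v : G) : has_path_of_length u v k -> has_path_of_length v u k.
  by apply/idP/idP; apply: reverse.
case/existsP => p /and3P[p_path /eqP p_last p_uniq].
have sz : size (rev (belast u p)) == k by rewrite size_rev size_belast size_tuple.
apply/existsP; exists (Tuple sz); apply/and3P; split.
- by rewrite -p_last rev_path (eq_path (e' := @sedge G)) // => a b; apply: sedge_sym.
- by rewrite /= -p_last; case: (tval p) => [|b q] //=; rewrite rev_cons last_rcons.
- by rewrite -p_last -rev_rcons -lastI rev_uniq.
Qed.

Lemma has_path_of_length_lt (G : sgraph) (x y : G) k :
  has_path_of_length x y k -> (k < #|G|)%N.
Proof.
case/existsP => p /and3P[_ _ /card_uniqP p_uniq].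
by move: (max_card (mem (x :: p))); rewrite p_uniq /= size_tuple.
Qed.

Lemma has_path_of_length0 (G : sgraph) (x y : G) : has_path_of_length x y 0 = (x == y).
Proof.
apply/existsP/idP => [[p]|/eqP->]; first by rewrite (tuple0 p) /= andbT.
by exists [tuple]; rewrite /= eqxx.
Qed.

Lemma has_path_of_length1 (G : sgraph) (x y : G) : has_path_of_length x y 1 = sedge x y.
Proof.
apply/existsP/idP => [[[[|z [|? ?]] //= _]]|xy].
  by rewrite andbT => /and3P[xz /eqP<- _].
by exists [tuple y]; rewrite /= xy eqxx inE sedge_neq.
Qed.

Lemma has_path_of_length_hom (G H : sgraph) (f : G -> H) (x y : G) k :
  injective f -> {homo f : u v / sedge u v} ->
  has_path_of_length x y k -> has_path_of_length (f x) (f y) k.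
Proof.
move=> f_inj f_hom /existsP[p /and3P[p_path /eqP p_last p_uniq]].
apply/existsP; exists (map_tuple f p); apply/and3P; split.
- exact: homo_path p_path.
- by rewrite last_map p_last.
- by rewrite -map_cons map_inj_uniq.
Qed.

Lemma gdist_sym (G : sgraph) (x y : G) : gdist x y = gdist y x.
Proof. by apply: eq_find => k; apply: has_path_of_length_sym. Qed.

Lemma gdist_le_card (G : sgraph) (x y : G) : (gdist x y <= #|G|)%N.
Proof. by rewrite -[leqRHS](size_iota 0); apply: find_size. Qed.

Lemma gdist_le (G : sgraph) (x y : G) k : has_path_of_length x y k -> (gdist x y <= k)%N.
Proof.
move=> xy_path; rewrite leqNgt; apply/negP => /(before_find 0%N).
by rewrite nth_iota ?add0n ?xy_path // (has_path_of_length_lt xy_path).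
Qed.

Lemma has_path_gdist (G : sgraph) (x y : G) :
  (gdist x y < #|G|)%N -> has_path_of_length x y (gdist x y).
Proof.
move=> dist_lt; have : has (has_path_of_length x y) (iota 0 #|G|).
  by rewrite has_find size_iota.
by move/(nth_find 0%N); rewrite nth_iota.
Qed.

Lemma gdist_hom (G H : sgraph) (f : G -> H) (x y : G) :
  injective f -> {homo f : u v / sedge u v} -> (#|H| <= #|G|)%N ->
  (gdist (f x) (f y) <= gdist x y)%N.
Proof.
move=> f_inj f_hom cardHG; have [dist_lt|dist_ge] := ltnP (gdist x y) #|G|.
  exact/gdist_le/has_path_of_length_hom/has_path_gdist.
by apply: leq_trans (gdist_le_card _ _) (leq_trans cardHG dist_ge).
Qed.

Lemma gdist_eq0 (G : sgraph) (x y : G) : (gdist x y == 0)%N = (x == y).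
Proof.
apply/eqP/eqP => [dist0|->]; last first.
  by apply/eqP; rewrite -leqn0 gdist_le ?has_path_of_length0.
apply/eqP; rewrite -has_path_of_length0 -dist0 has_path_gdist // dist0.
by apply/card_gt0P; exists x.
Qed.

Lemma gdistxx (G : sgraph) (x : G) : gdist x x = 0%N.
Proof. by apply/eqP; rewrite gdist_eq0. Qed.

Lemma gdist_eq1 (G : sgraph) (x y : G) : (gdist x y == 1)%N = sedge x y.
Proof.
apply/eqP/idP => [dist1|xy]; last first.
  apply/eqP; rewrite eqn_leq gdist_le ?has_path_of_length1 // lt0n gdist_eq0.
  exact: sedge_neq.
rewrite -has_path_of_length1 -dist1 has_path_gdist // dist1 (cardD1 x).
by rewrite ltnS; apply/card_gt0P; exists y; rewrite !inE andbT eq_sym -gdist_eq0 dist1.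
Qed.

Lemma gdist_le2 (G : sgraph) (x y z : G) : sedge x z -> sedge z y -> (gdist x y <= 2)%N.
Proof.
move=> xz zy; have [->|xy] := eqVneq x y; first by rewrite gdistxx.
apply/gdist_le/existsP; exists [tuple z; y].
by rewrite /= xz zy eqxx !inE negb_or xy !sedge_neq.
Qed.

Lemma distance_matrix_sym (R : realType) (G : sgraph) :
  (distance_matrix R G)^T = distance_matrix R G.
Proof. by apply/matrixP => i j; rewrite !mxE gdist_sym. Qed.

(* Transporting the Perron vector of H to G, the larger distances of G would push
   its quadratic form beyond the largest eigenvalue. *)
Lemma spanning_subgraph_iso (R : realType) (G H : sgraph) (f : G -> H) :
  (0 < #|H|)%N -> bijective f -> {homo f : u v / sedge u v} ->
  largest_eigenvalue (distance_matrix R G) <= largest_eigenvalue (distance_matrix R H) ->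
  graph_iso G H.
Proof.
move=> H_gt0 f_bij f_hom lam_le.
have [x x_gt0 xD] : exists2 x : 'rV[R]_#|H|, forall i, 0 < x 0 i
    & x *m distance_matrix R H = largest_eigenvalue (distance_matrix R H) *: x.
  apply: largest_eigenvalue_perron => // [|i j ij]; first exact: distance_matrix_sym.
  by rewrite mxE ltr0n lt0n gdist_eq0 (inj_eq enum_val_inj).
pose h (i : 'I_#|G|) : 'I_#|H| := enum_rank (f (enum_val i)).
have h_bij : bijective h.
  exact: bij_comp (@enum_rank_bij H) (bij_comp f_bij (@enum_val_bij G)).
have gdistE : mxsub h h (distance_matrix R H) = distance_matrix R G.
  apply: (entrywise_le_largest_eigenvalue_eq (x := colsub h x) (distance_matrix_sym R G)
    _ _ _ lam_le).
  - move=> i j; rewrite !mxE !enum_rankK ler_nat gdist_hom ?(bij_eq_card f_bij) //.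
    exact: bij_inj.
  - by move=> i; rewrite mxE.
  - apply/rowP => j; have /rowP/(_ (h j)) := xD; rewrite !mxE => <-.
    rewrite [RHS](reindex _ (onW_bij _ h_bij)) /=.
    by apply: eq_bigr => i _; rewrite !mxE.
exists f => // u v; rewrite -!gdist_eq1.
have /matrixP/(_ (enum_rank u) (enum_rank v)) := gdistE.
by rewrite !mxE !enum_rankK => /eqP; rewrite eqr_nat => /eqP->.
Qed.

(** * Bounds on the distance spectral radius *)

Definition nonadjacent_pairs (G : sgraph) : {set G * G} :=
  [set p | (p.1 != p.2) && ~~ sedge p.1 p.2].

Lemma sum_gdist_ge (G : sgraph) :
  (#|G| * #|G|.-1 + #|nonadjacent_pairs G| <= \sum_(x : G) \sum_(y : G) gdist x y)%N.
Proof.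
have -> : (#|G| * #|G|.-1 = \sum_(x : G) \sum_(y : G) (x != y))%N.
  rewrite -sum_nat_const; apply: eq_bigr => x _.
  rewrite -(cardC1 x) -sum1_card big_mkcond /=.
  by apply: eq_bigr => y _; rewrite !inE eq_sym; case: (x == y).
have -> : #|nonadjacent_pairs G| = (\sum_(x : G) \sum_(y : G) ((x != y) && ~~ sedge x y))%N.
  rewrite pair_big /= -sum1_card big_mkcond /=.
  by apply: eq_bigr => p _; rewrite inE; case: (_ && _).
rewrite -big_split; apply: leq_sum => x _ /=; rewrite -big_split; apply: leq_sum => y _ /=.
rewrite -gdist_eq0 -gdist_eq1.
by case: (gdist x y) => [|[|d]].
Qed.

Lemma big_enum_valT (R : Type) (idx : R) (op : Monoid.com_law idx) (T : finType)
    (F : T -> R) :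
  \big[op/idx]_(i < #|T|) F (enum_val i) = \big[op/idx]_x F x.
Proof. by rewrite -(big_enum_val (A := T)). Qed.

Lemma largest_eigenvalue_ge_nonadjacent_pairs (R : realType) (G : sgraph) :
  (0 < #|G|)%N ->
  #|G|.-1%:R + #|nonadjacent_pairs G|%:R / #|G|%:R
    <= largest_eigenvalue (distance_matrix R G).
Proof.
move=> G_gt0; have G_gt0R : 0 < #|G|%:R :> R by rewrite ltr0n.
have := quadform_le_largest G_gt0 (distance_matrix_sym R G) (const_mx 1).
rewrite sqrnormE; under [\sum_i _]eq_bigr do rewrite mxE expr1n.
rewrite sumr_const card_ord -ler_pdivrMr //; apply: le_trans.
rewrite ler_pdivlMr // mulrDl divfK ?gt_eqF // mulrC -natrM -natrD.
have -> : quadform (distance_matrix R G) (const_mx 1)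
    = (\sum_(x : G) \sum_(y : G) gdist x y)%N%:R.
  rewrite quadformE natr_sum -[RHS]big_enum_valT; apply: eq_bigr => i _.
  rewrite natr_sum -[RHS]big_enum_valT; apply: eq_bigr => j _.
  by rewrite !mxE mul1r mulr1.
by rewrite ler_nat sum_gdist_ge.
Qed.

Lemma largest_eigenvalue_gt_nonadjacent_pairs (R : realType) (G : sgraph) k :
  (k.+1 * #|G| < #|nonadjacent_pairs G|)%N ->
  #|G|%:R + k%:R < largest_eigenvalue (distance_matrix R G).
Proof.
move=> pairs_gt; have [G_gt0|G0] := ltnP 0 #|G|; last first.
  move: pairs_gt; rewrite ltnNge => /negP[]; rewrite (leq_trans (max_card _)) //.
  by rewrite card_prod leq_mul // (leq_trans G0).
have ratio_gt : k.+1%:R < #|nonadjacent_pairs G|%:R / #|G|%:R :> R.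
  by rewrite ltr_pdivlMr ?ltr0n // -natrM ltr_nat.
have := largest_eigenvalue_ge_nonadjacent_pairs R G_gt0.
have cardE : #|G|%:R = #|G|.-1%:R + 1 :> R by rewrite natr1 prednK.
by rewrite -natr1 in ratio_gt; lra.
Qed.

Lemma largest_eigenvalue_le_weighted_row_sums (R : realType) (G : sgraph)
    (w : G -> nat) k :
  (0 < #|G|)%N -> (forall x, 0 < w x)%N ->
  (forall x, \sum_y gdist x y * w y <= k * w x)%N ->
  largest_eigenvalue (distance_matrix R G) <= k%:R.
Proof.
move=> G_gt0 w_gt0 row_le; apply: le_trans (ler_norm _) _.
apply: (collatz_wielandt_normr_eigenvalue_le (x := \col_i (w (enum_val i))%:R) _ _ _
  (eigenvalue_largest G_gt0 (distance_matrix_sym R G))) => [i j|i|i].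
- by rewrite mxE ler0n.
- by rewrite mxE ltr0n.
rewrite !mxE -natrM.
apply: (@le_trans _ _ (\sum_y gdist (enum_val i) y * w y)%N%:R); last by rewrite ler_nat.
rewrite natr_sum -[leRHS]big_enum_valT; apply: ler_sum => j _.
by rewrite !mxE natrM.
Qed.

(* Weighted row sums, with weight 2 on a and 1 elsewhere. *)
Lemma largest_eigenvalue_le_almost_complete (R : realType) (G : sgraph) (a : G) :
  (forall x y : G, (gdist x y <= 2)%N) ->
  (forall x y : G, x != a -> y != a -> (gdist x y <= 1)%N) ->
  largest_eigenvalue (distance_matrix R G) <= #|G|%:R + 2.
Proof.
move=> dist_le2 dist_le1; rewrite -natrD.
pose w (x : G) : nat := (if x == a then 2 else 1)%N.
have wa : w a = 2%N by rewrite /w eqxx.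
have w_neq x : x != a -> w x = 1%N by rewrite /w => /negPf->.
apply: (@largest_eigenvalue_le_weighted_row_sums _ _ w) => [|x|x].
- by apply/card_gt0P; exists a.
- by rewrite /w; case: ifP.
have [->|xa] := eqVneq x a.
  rewrite (bigD1 a) //= gdistxx wa.
  apply: (@leq_trans (\sum_(y : G) 2)%N); last by rewrite sum_nat_const cardT -cardE; lia.
  rewrite [leqRHS](bigD1 a) //= leq_add //.
  by apply: leq_sum => y /w_neq->; rewrite muln1.
rewrite (bigD1 a) // (bigD1 x) //= gdistxx wa w_neq //.
have rest_le : (\sum_(y | (y != a) && (y != x)) gdist x y * w y <= #|~: [set a; x]|)%N.
  rewrite -sum1_card [leqRHS](eq_bigl (fun y => (y != a) && (y != x))).
    by apply: leq_sum => y /andP[ya _]; rewrite w_neq // muln1 dist_le1.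
  by move=> y; rewrite !inE negb_or.
have := dist_le2 x a; have := cardsC [set a; x].
by rewrite cards2 eq_sym xa => <- /=; lia.
Qed.

(** * Pairs separated by a cut *)

Lemma sum_sqr_le_sqr_sum (I : finType) (D : {pred I}) (F : I -> nat) :
  (\sum_(i in D) F i ^ 2 <= (\sum_(i in D) F i) ^ 2)%N.
Proof.
rewrite -mulnn big_distrl /=; apply: leq_sum => i iD.
by rewrite -mulnn leq_mul2l (bigD1 i) //= leq_addr orbT.
Qed.

Lemma sum_sqr_bounded_below_le (I : finType) (D : {pred I}) (F : I -> nat) m :
  (forall i, i \in D -> m <= F i)%N ->
  (\sum_(i in D) F i ^ 2 + #|D|.-1 * m * (2 * (\sum_(i in D) F i) - #|D| * m)
    <= (\sum_(i in D) F i) ^ 2)%N.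
Proof.
move=> F_ge; have [/card0_eq D0|] := posnP #|D|; first by rewrite !big_pred0 // eq_card0.
case: #|D| (sum_nat_const D) => // c sum_const _; pose B i := (F i - m)%N.
have F_E i : i \in D -> F i = (m + B i)%N by move=> iD; rewrite subnKC ?F_ge.
have -> : (\sum_(i in D) F i = c.+1 * m + \sum_(i in D) B i)%N.
  by rewrite (eq_bigr _ F_E) big_split /= sum_const.
have -> : (\sum_(i in D) F i ^ 2
    = c.+1 * m ^ 2 + 2 * m * (\sum_(i in D) B i) + \sum_(i in D) B i ^ 2)%N.
  rewrite big_distrr -sum_const -!big_split /=; apply: eq_bigr => i /F_E->.
  by rewrite sqrnD addnAC mulnA.
move: (sum_sqr_le_sqr_sum D B); set b := (\sum_(i in D) B i)%N => sqr_le.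
have -> : (2 * (c.+1 * m + b) - c.+1 * m = c.+1 * m + 2 * b)%N by lia.
have -> : ((c.+1 * m + b) ^ 2
    = c.+1 * m ^ 2 + 2 * m * b + c * m * (c.+1 * m + 2 * b) + b ^ 2)%N by ring.
by rewrite addnAC leq_add2l.
Qed.

Section SeparatedPairs.
Variables (T I : finType) (f : T -> I).

Lemma sum_over_fibers (g : I -> nat) :
  (\sum_x g (f x) = \sum_(i in f @: [set: T]) #|[set y | f y == i]| * g i)%N.
Proof.
rewrite (partition_big f [in f @: [set: T]]) /= => [|x _]; last by rewrite imset_f ?inE.
by apply: eq_bigr => i _; rewrite -sum_nat_cond_const; apply: eq_bigr => x /eqP->.
Qed.

Lemma card_fiber_pairs :
  #|[set p : T * T | f p.1 == f p.2]|
    = (\sum_(i in f @: [set: T]) #|[set y | f y == i]| ^ 2)%N.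
Proof.
under [RHS]eq_bigr do rewrite -mulnn; rewrite -sum_over_fibers.
rewrite -sum1_card (eq_bigl (fun p : T * T => f p.1 == f p.2)) => [|p]; last by rewrite inE.
rewrite -(pair_big_dep xpredT (fun x y => f x == f y) (fun _ _ => 1%N)) /=.
apply: eq_bigr => x _; rewrite -sum1_card.
by apply: eq_bigl => y; rewrite inE eq_sym.
Qed.

(* Equality holds when all fibers but one have exactly m elements. *)
Lemma card_separated_pairs_ge m (c := #|f @: [set: T]|) :
  (forall x, m <= #|[set y | f y == f x]|)%N ->
  (c.-1 * m * (2 * #|T| - c * m) <= #|[set p : T * T | f p.1 != f p.2]|)%N.
Proof.
move=> fiber_ge.
have fibers : #|T| = (\sum_(i in f @: [set: T]) #|[set y | f y == i]|)%N.
  rewrite -sum1_card (sum_over_fibers (fun _ => 1%N)).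
  by apply: eq_bigr => i _; rewrite muln1.
have image_fiber_ge i : i \in f @: [set: T] -> (m <= #|[set y | f y == i]|)%N.
  by move=> /imsetP[x _ ->].
move: (sum_sqr_bounded_below_le image_fiber_ge); rewrite -fibers -card_fiber_pairs.
have -> : (#|T| ^ 2 = #|{: T * T}|)%N by rewrite card_prod mulnn.
rewrite -(cardsC [set p : T * T | f p.1 == f p.2]) leq_add2l.
suff -> : ~: [set p : T * T | f p.1 == f p.2] = [set p | f p.1 != f p.2] by [].
by apply/setP => p; rewrite !inE.
Qed.
End SeparatedPairs.

Definition neighborhood (G : sgraph) (x : G) : {set G} := [set y | sedge x y].

Definition component (G : sgraph) (x : G) : {set G} := [set y | connect (@sedge G) x y].

Lemma root_eq_component (G : sgraph) (x : G) :
  [set y | fingraph.root (@sedge G) y == fingraph.root (@sedge G) x] = component x.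
Proof.
apply/setP => y.
by rewrite !inE eq_sym root_connect //; apply: sedge_connect_sym.
Qed.

Lemma num_components_roots (G : sgraph) :
  num_components G = #|fingraph.root (@sedge G) @: [set: G]|.
Proof.
apply: eq_card => x; rewrite !inE andbT; apply/eqP/imsetP => [<-|[y _ ->]].
  by exists x.
exact/root_root/sedge_connect_sym.
Qed.

Lemma num_components_le (G : sgraph) : (num_components G <= #|G|)%N.
Proof. exact: max_card. Qed.

Lemma card_induced_graph (G : sgraph) (A : {set G}) : #|induced_graph A| = #|A|.
Proof. by rewrite card_sig. Qed.

Lemma card_neighborhood_lt (G : sgraph) (S : {set G}) (x : induced_graph (~: S)) :
  (#|neighborhood (val x)| < #|S| + #|component x|)%N.
Proof.
have xC : x \in component x by rewrite inE connect0.
have sub : neighborhood (val x) \subset S :|: val @: (component x :\ x).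
  apply/subsetP => y; rewrite !inE => xy; case: (boolP (y \in S)) => //= yS.
  have yS' : y \in ~: S by rewrite inE.
  apply/imsetP; exists (Sub y yS' : induced_graph (~: S)) => //.
  rewrite !inE connect1 // andbT.
  by rewrite eq_sym -(inj_eq val_inj) sedge_neq.
rewrite (cardsD1 x (component x)) xC addnS ltnS (leq_trans (subset_leq_card sub)) //.
by rewrite (leq_trans (leq_card_setU _ _)) // leq_add2l leq_imset_card.
Qed.

Lemma nonadjacent_pairs_ge_cut (G : sgraph) (S : {set G}) m :
  (forall x : induced_graph (~: S), m <= #|component x|)%N ->
  ((comp_minus S).-1 * m * (2 * (#|G| - #|S|) - comp_minus S * m)
    <= #|nonadjacent_pairs G|)%N.
Proof.
move=> comp_ge; set H := induced_graph (~: S); pose r := fingraph.root (@sedge H).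
pose val2 (p : H * H) : G * G := (val p.1, val p.2).
have val2_inj : injective val2.
  by move=> [x y] [x' y'] [/val_inj /= -> /val_inj /= ->].
apply: (@leq_trans #|[set p : H * H | r p.1 != r p.2]|).
  have -> : (#|G| - #|S| = #|H|)%N by rewrite card_induced_graph -(cardsC S) addKn.
  rewrite /comp_minus num_components_roots; apply: card_separated_pairs_ge => x.
  by rewrite root_eq_component.
rewrite -(card_imset _ val2_inj); apply/subset_leq_card/subsetP => _ /imsetP[p + ->].
rewrite !inE /= (inj_eq val_inj) (root_connect (@sedge_connect_sym H)) => p_sep.
apply/andP; split.
- by apply: contraNN p_sep => /eqP->; apply: connect0.
- by apply: contraNN p_sep => p_adj; apply: connect1.
Qed.

Lemma not_tough_cut (t : nat) (G : sgraph) : ~~ is_tough t%:R G ->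
  exists2 S : {set G}, is_cut S & (#|S| < t * (comp_minus S).-1)%N.
Proof.
rewrite /is_tough /toughness; case: pickP => // S0 cutS0.
case: arg_minP => // S cutS _; rewrite -ltNge => ratio_lt; exists S => //.
move: ratio_lt; rewrite /cut_ratio ltr_pdivrMr -?natrM ?ltr_nat //.
by rewrite ltr0n; move: cutS; rewrite /is_cut; lia.
Qed.

(* Since 4 t^2 + 5 t + 1 = (t + 1) (4 t + 1), the case n <= k (t + 1) forces
   k >= 4 t + 1. *)
Lemma cut_pairs_count_gt (t n s k : nat) : (2 <= t)%N -> (2 <= k)%N ->
  (4 * t ^ 2 + 5 * t + 1 <= n)%N -> (s < t * k)%N -> (s + k < n)%N ->
  (3 * n < k * (2 * (n - s) - k.+1))%N.
Proof.
move=> t_ge2 k_ge2 n_ge s_lt sk_lt.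
have [big_k|small_k] := leqP n (k * t.+1).
  have k_ge : (4 * t + 1 <= k)%N by nia.
  have : (k * k.+1 <= k * (2 * (n - s) - k.+1))%N.
    by rewrite leq_mul2l; apply/orP; right; lia.
  by apply: leq_trans; nia.
have [j jE] : exists j, n = (k * t.+1 + j)%N by exists (n - k * t.+1)%N; lia.
have : (k * (2 * j + k.+1) <= k * (2 * (n - s) - k.+1))%N.
  by rewrite leq_mul2l; apply/orP; right; nia.
apply: leq_trans.
have [i iE] : exists i, k = i.+2 by exists k.-2; lia.
nia.
Qed.

Lemma nonadjacent_pairs_gt_min_degree (t n : nat) (G : sgraph) (S : {set G}) :
  (2 <= t)%N -> #|G| = n -> (4 * t ^ 2 + 5 * t + 1 <= n)%N ->
  (forall x : G, t <= #|neighborhood x|)%N ->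
  is_cut S -> (#|S| < t * (comp_minus S).-1)%N ->
  (3 * n < #|nonadjacent_pairs G|)%N.
Proof.
move=> t_ge2 cardG n_ge deg_ge; rewrite /is_cut => c_gt1 S_lt.
have c_le : (comp_minus S <= n - #|S|)%N.
  by rewrite -cardG -(cardsC S) addKn -card_induced_graph num_components_le.
have [c_gt2|c_le2] := ltnP 2 (comp_minus S).
  have comp_ge1 (x : induced_graph (~: S)) : (1 <= #|component x|)%N.
    by apply/card_gt0P; exists x; rewrite inE connect0.
  apply: leq_trans (nonadjacent_pairs_ge_cut comp_ge1); rewrite !muln1 cardG.
  rewrite -[in X in (_ - X)%N](prednK (ltnW c_gt1)).
  by apply: (@cut_pairs_count_gt t) => //; lia.
have c2 : comp_minus S = 2%N by lia.
rewrite c2 muln1 in S_lt.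
have comp_ge2 (x : induced_graph (~: S)) : (2 <= #|component x|)%N.
  by have := card_neighborhood_lt x; have := deg_ge (val x); lia.
apply: leq_trans (nonadjacent_pairs_ge_cut comp_ge2); rewrite c2 cardG /=.
by have : (13 * t + 1 <= n)%N; [nia | lia].
Qed.

(** * The extremal graph *)

Section ExtremalGraph.
Variables t n : nat.
Local Notation K := (extremal_graph t n).

Definition extremal_apex : K := inr (inr ord0).

Definition extremal_base : {set K} := [set x : K | if x is inl _ then true else false].

Lemma extremal_apexN : extremal_apex \notin extremal_base.
Proof. by rewrite inE. Qed.

Lemma sedge_extremal (x y : K) :
  sedge x y = [&& x != y, (x == extremal_apex) ==> (y \in extremal_base)
                & (y == extremal_apex) ==> (x \in extremal_base)].
Proof.
have apexE (z : K) : (z == extremal_apex) = (if z is inr (inr _) then true else false).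
  by case: z => [z|[z|z]] //; rewrite (ord1 z) eqxx.
rewrite !apexE; case: x y => [x|[x|x]] [y|[y|y]]; rewrite !inE //= ?andbT ?andbF //.
by rewrite (ord1 x) (ord1 y).
Qed.

Lemma card_extremal_base : #|extremal_base| = (t - 1)%N.
Proof.
have -> : extremal_base = inl @: [set: 'I_(t - 1)].
  apply/setP => -[x|x]; rewrite inE; first by rewrite imset_f.
  by apply/esym/negbTE/imsetP => -[].
by rewrite card_imset ?cardsT ?card_ord // => ? ? [].
Qed.

Lemma card_extremal_graph : (0 < t <= n)%N -> #|K| = n.
Proof. by rewrite !card_sum !card_ord; lia. Qed.

Lemma gdist_extremal_le2 (x y : K) : (1 < t)%N -> (gdist x y <= 2)%N.
Proof.
move=> t_gt1; have [->|xy] := eqVneq x y; first by rewrite gdistxx.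
have [adj|nadj] := boolP (sedge x y); first by move: adj; rewrite -gdist_eq1 => /eqP->.
have base_adj (u v : K) : u \in extremal_base -> u != v -> sedge u v.
  move=> uB uv; rewrite sedge_extremal uv uB implybT andbT /=.
  by apply/implyP => /eqP uE; rewrite uE (negPf extremal_apexN) in uB.
have /card_gt0P[z zB] : (0 < #|extremal_base|)%N by rewrite card_extremal_base subn_gt0.
have zN (u v : K) : u != v -> ~~ sedge u v -> z != u.
  by move=> uv; apply: contraNneq => zu; rewrite base_adj // -zu.
apply: (@gdist_le2 _ _ _ z); last by rewrite base_adj ?(zN y x) // 1?eq_sym // sedge_sym.
by rewrite sedge_sym base_adj ?(zN x y).
Qed.

Lemma largest_eigenvalue_extremal_le (R : realType) :
  (1 < t <= n)%N -> largest_eigenvalue (distance_matrix R K) <= n%:R + 2.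
Proof.
case/andP=> t_gt1 t_le; rewrite -[in leRHS]card_extremal_graph; last by rewrite ltnW.
apply: (@largest_eigenvalue_le_almost_complete _ _ extremal_apex) => [x y|x y xa ya].
  exact: gdist_extremal_le2.
have [->|xy] := eqVneq x y; first by rewrite gdistxx.
have /eqP-> // : (gdist x y == 1)%N.
by rewrite gdist_eq1 sedge_extremal xy (negPf xa) (negPf ya).
Qed.
End ExtremalGraph.

Lemma exists_bij_imset_subset (T U : finType) (A : {set T}) (B : {set U}) :
  #|T| = #|U| -> (#|A| <= #|B|)%N ->
  exists2 f : T -> U, bijective f & f @: A \subset B.
Proof.
move=> cardTU cardAB.
pose sT := enum A ++ enum (~: A); pose sU := enum B ++ enum (~: B).
have enum_split (V : finType) (D : {set V}) (s := enum D ++ enum (~: D)) :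
    [/\ uniq s, s =i V & size s = #|V|].
  have s_uniq : uniq s.
    rewrite cat_uniq !enum_uniq andbT; apply/hasPn => x.
    by rewrite !mem_enum inE.
  have sV : s =i V by move=> x; rewrite mem_cat !mem_enum inE orbN.
  by split=> //; rewrite -(card_uniqP s_uniq) (eq_card sV).
have [sT_uniq memT sizeT] := enum_split T A; have [sU_uniq _ sizeU] := enum_split U B.
have index_lt x : (index x sT < size sU)%N by rewrite sizeU -cardTU -sizeT index_mem memT.
pose f x := tnth (in_tuple sU) (Ordinal (index_lt x)).
have fE u0 x : f x = nth u0 sU (index x sT) by rewrite /f (tnth_nth u0).
exists f.
  apply: inj_card_bij; last by rewrite cardTU.
  move=> x y; rewrite (fE (f x)) [RHS](fE (f x)) => /eqP.
  by rewrite nth_uniq // => /eqP/index_inj -> //; rewrite memT.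
apply/subsetP => _ /imsetP[x xA ->]; rewrite (fE (f x)) nth_cat index_cat mem_enum xA.
have x_lt : (index x (enum A) < size (enum B))%N.
  by rewrite -cardE (leq_trans _ cardAB) // cardE index_mem mem_enum.
by rewrite x_lt -mem_enum mem_nth.
Qed.

Lemma low_degree_spanning_subgraph (t n : nat) (G : sgraph) (v : G) :
  (0 < t <= n)%N -> #|G| = n -> (#|neighborhood v| < t)%N ->
  exists2 f : G -> extremal_graph t n, bijective f & {homo f : x y / sedge x y}.
Proof.
move=> t_bounds cardG deg_v.
have [g g_bij gB] :
    exists2 g : G -> extremal_graph t n,
      bijective g & g @: neighborhood v \subset extremal_base t n.
  apply: exists_bij_imset_subset; first by rewrite card_extremal_graph.
  by rewrite card_extremal_base; lia.
have g_inj := bij_inj g_bij; pose a := extremal_apex t n.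
exists (tperm (g v) a \o g); first exact: bij_comp (injF_bij (@perm_inj _ _)) g_bij.
have f_apex x : (tperm (g v) a (g x) == a) = (x == v).
  by rewrite -[X in _ == X](tpermL (g v)) (inj_eq perm_inj) (inj_eq g_inj).
have f_base x : sedge v x -> tperm (g v) a (g x) \in extremal_base t n.
  move=> vx; have gxB : g x \in extremal_base t n.
    by apply: (subsetP gB); rewrite imset_f ?inE.
  rewrite tpermD // eq_sym.
    by rewrite (inj_eq g_inj) eq_sym sedge_neq.
  by apply: contraTneq gxB => ->; apply: extremal_apexN.
move=> x y xy; rewrite sedge_extremal /= !f_apex (inj_eq perm_inj) (inj_eq g_inj).
apply/and3P; split.
- exact: sedge_neq.
- by apply/implyP => /eqP xv; rewrite f_base -?xv.
- by apply/implyP => /eqP yv; rewrite f_base // sedge_sym -yv.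
Qed.

Theorem theorem1p2 (R : realType) (t n : nat) (G : sgraph)
    (ht : (2 <= t)%N) (hG : connected_graph G) (hn : #|G| = n)
    (hnt : (4 * t ^ 2 + 5 * t + 1 <= n)%N)
    (hlam : largest_eigenvalue (distance_matrix R G)
            <= largest_eigenvalue (distance_matrix R (extremal_graph t n))) :
  is_tough t%:R G \/ graph_iso G (extremal_graph t n).
Proof.
have t_bounds : (1 < t <= n)%N by lia.
have [|/not_tough_cut[S cutS S_lt]] := boolP (is_tough t%:R G); [by left | right].
have [/existsP[v deg_v]|/existsPn deg_ge] := boolP [exists v : G, #|neighborhood v| < t]%N.
  have [|f f_bij f_hom] := low_degree_spanning_subgraph _ hn deg_v; first by lia.
  by apply: spanning_subgraph_iso f_bij f_hom hlam; rewrite card_extremal_graph; lia.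
have pairs_gt : (3 * #|G| < #|nonadjacent_pairs G|)%N.
  rewrite [in ltnLHS]hn.
  apply: (nonadjacent_pairs_gt_min_degree ht hn hnt _ cutS S_lt) => x.
  by rewrite leqNgt deg_ge.
have lam_gt := largest_eigenvalue_gt_nonadjacent_pairs R pairs_gt.
have lam_le := le_trans hlam (largest_eigenvalue_extremal_le R t_bounds).
by have := lt_le_trans lam_gt lam_le; rewrite hn ltxx.
Qed.
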